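(* There exist a finitely generated non-amenable group $\Gamma$ with a finite symmetric generating system $\Sigma$, and finite index subgroups $\Gamma\supset H_1\supset H_2\supset\cdots$ with $\bigcap_{i=1}^\infty H_i=\{e_\Gamma\}$, such that the associated sequence of Schreier graphs $\{\mathrm{Sch}(\Gamma/H_i,\Sigma)\}_{i=1}^\infty$ is of Property A.
   Context: For a finite index subgroup $H$ of $\Gamma$, the (left) Schreier graph $\mathrm{Sch}(\Gamma/H,\Sigma)$ has as vertices the left cosets $gH$, $g\in\Gamma$, with $gH$ adjacent to $sgH$ for $s\in\Sigma$ (loops and multiple edges play no role). A sequence of finite graphs is said to be of Property A if the infinite graph $S$ formed by the disjoint union of the graphs in the sequence is of Property A in the following sense. A finite graph $F$ is weighted $(\epsilon,K)$-hyperfinite if for every nonnegative function $w:V(F)\to\mathbb{R}$ there is a subset $Y\subset V(F)$ such that $\sum_{y\in Y}w(y)\le\epsilon\sum_{x\in V(F)}w(x)$ and, after removing $Y$ from $V(F)$ together with all incident edges, all connected components of the resulting graph have at most $K$ vertices. A class $\mathcal{G}$ of finite graphs is weighted hyperfinite if for every $\epsilon>0$ there exists $K>0$ such that every $F\in\mathcal{G}$ is weighted $(\epsilon,K)$-hyperfinite. An infinite graph $S$ of bounded vertex degrees (not necessarily connected) is of Property A if the class $\mathcal{G}_S$ of all finite subgraphs of $S$ is weighted hyperfinite. *)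

(* Defs.v *)
From Stdlib Require Eqdep_dec PeanoNat.
From HB Require Import structures.
From mathcomp Require Export all_boot all_order all_algebra.
From mathcomp Require Export all_classical all_reals.

Set Implicit Arguments.
Unset Strict Implicit.
Unset Printing Implicit Defensive.

Import Order.TTheory GRing.Theory Num.Theory.
Local Open Scope classical_set_scope.
Local Open Scope ring_scope.

Definition is_subgroup (G : groupType) (H : set G) : Prop :=
  [/\ H 1%g,
      (forall x y, H x -> H y -> H (x * y)%g)
    & (forall x, H x -> H (x^-1)%g)].

Definition symmetric_set (G : groupType) (S : set G) : Prop :=
  forall s, S s -> S (s^-1)%g.

Definition generates (G : groupType) (S : set G) : Prop :=
  smallest (@is_subgroup G) S = [set: G].

Definition lcoset (G : groupType) (g : G) (H : set G) : set G :=
  [set (g * h)%g | h in H].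

Definition lcosets (G : groupType) (H : set G) : set (set G) :=
  [set lcoset g H | g in [set: G]].

Definition finite_index (G : groupType) (H : set G) : Prop :=
  finite_set (lcosets H).

(* Amenability in the sense of von Neumann: existence of a finitely additive,
   left-invariant probability measure defined on all subsets. *)
Definition amenable (R : realType) (G : groupType) : Prop :=
  exists mu : set G -> R,
    [/\ (forall A, 0 <= mu A),
        mu [set: G] = 1,
        (forall A B, A `&` B = set0 -> mu (A `|` B) = mu A + mu B)
      & (forall g A, mu (lcoset g A) = mu A)].

Record graph := Graph {
  vertex :> Type;
  adj : vertex -> vertex -> Prop;
  adj_sym : forall x y, adj x y -> adj y x;
  adj_irrefl : forall x, ~ adj x x
}.

Record fgraph := FGraph {
  fvertex :> finType;
  fadj : rel fvertex;
  fadj_sym : symmetric fadj;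
  fadj_irrefl : irreflexive fadj
}.

(* F is, up to isomorphism, a (not necessarily induced) subgraph of S. *)
Definition finite_subgraph (S : graph) (F : fgraph) : Prop :=
  exists f : F -> S,
    injective f /\ (forall x y : F, fadj x y -> adj (f x) (f y)).

Definition bounded_degree (S : graph) : Prop :=
  exists d : nat, forall x : S, ([set y | adj x y] #<= `I_d)%card.

Definition delete_vertices (F : fgraph) (Y : {set F}) : rel F :=
  [rel x y | [&& x \notin Y, y \notin Y & fadj x y]].

(* For x outside Y, the component of x in F - Y is
   [set y | connect (delete_vertices Y) x y]. *)
Definition weighted_hyperfinite_graph (R : realType) (eps : R) (K : nat)
    (F : fgraph) : Prop :=
  forall w : F -> R, (forall x, 0 <= w x) ->
    exists Y : {set F},
      \sum_(y in Y) w y <= eps * \sum_(x : F) w x /\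
      (forall x, x \notin Y ->
         (#|[set y | connect (delete_vertices Y) x y]%SET| <= K)%N).

Definition weighted_hyperfinite (R : realType) (C : fgraph -> Prop) : Prop :=
  forall eps : R, 0 < eps ->
    exists K : nat, (0 < K)%N /\
      forall F, C F -> weighted_hyperfinite_graph eps K F.

Definition propertyA (R : realType) (S : graph) : Prop :=
  bounded_degree S /\ weighted_hyperfinite R (finite_subgraph S).

Section DisjointUnion.
Variable Gs : nat -> graph.

Inductive dunion_adj : {i : nat & Gs i} -> {i : nat & Gs i} -> Prop :=
  DunionAdj i (x y : Gs i) :
    adj x y -> dunion_adj (existT _ i x) (existT _ i y).

Lemma dunion_adj_sym u v : dunion_adj u v -> dunion_adj v u.
Proof. by case=> i x y /adj_sym; constructor. Qed.

Lemma dunion_adj_irrefl u : ~ dunion_adj u u.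
Proof.
suff H v w : dunion_adj v w -> v <> w by move/H; exact.
case=> i x y xy e; move: xy.
have -> : x = y by apply: (Eqdep_dec.inj_pair2_eq_dec _ PeanoNat.Nat.eq_dec) e.
exact: adj_irrefl.
Qed.

Definition disjoint_union : graph := Graph dunion_adj_sym dunion_adj_irrefl.

End DisjointUnion.

Definition seq_propertyA (R : realType) (Gs : nat -> graph) : Prop :=
  propertyA R (disjoint_union Gs).

(* Schreier graphs.  The vertices are the left cosets themselves.  The relation
   is symmetrized and loops are discarded, so that it is a simple graph for any
   set S; for symmetric S the symmetrization changes nothing. *)

Section Schreier.
Variables (G : groupType) (H S : set G).

Definition schreier_vertex := {A : set G | lcosets H A}.

Definition schreier_step (A B : schreier_vertex) : Prop :=
  exists g s, [/\ S s, sval A = lcoset g H & sval B = lcoset (s * g)%g H].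

Definition schreier_adj (A B : schreier_vertex) : Prop :=
  A <> B /\ (schreier_step A B \/ schreier_step B A).

Lemma schreier_adj_sym A B : schreier_adj A B -> schreier_adj B A.
Proof. by case=> AB [] ?; split; [exact: nesym|right|exact: nesym|left]. Qed.

Lemma schreier_adj_irrefl A : ~ schreier_adj A A.
Proof. by case. Qed.

Definition schreier_graph : graph :=
  Graph schreier_adj_sym schreier_adj_irrefl.

End Schreier.

(* Main.v *)
(* The group is Z/2 * Z/2 * Z/2.  A finite set T of reduced words containing 1
   carries an action of it: a generator x moves u to xu when xu lies in T and
   fixes u otherwise.  The stabiliser H_T of 1 has finite index, and its
   Schreier graph is, up to loops, the part of the Cayley tree spanned by T.
   Opening one loop, of generator x at v say, replaces T by the union of T and
   T r with r = v^-1 x v; the two halves are joined by the single edge from v to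
   xv, so mapping t r back to t is equivariant and H_{T'} is contained in H_T.
   Opening loops along every word in turn makes T exhaust the group, whence the
   stabilisers intersect trivially although all the Schreier graphs are finite
   trees, and a forest is weighted hyperfinite by cutting one depth class
   modulo k. *)
From HB Require Import structures.
Require Import Defs.
From mathcomp Require Import lra.

Local Open Scope classical_set_scope.

Set Implicit Arguments.
Unset Strict Implicit.
Unset Printing Implicit Defensive.
Import Order.TTheory GRing.Theory Num.Theory.

(** * Reduced words and the free product of copies of Z/2 *)

Section Words.
Variable I : finType.
Implicit Types (x y : I) (s u v w : seq I).

Definition reduced w := sorted (fun x y => x != y) w.

Definition push x w :=
  if w is y :: w' then if x == y then w' else x :: w else [:: x].

Definition mulw u w := foldr push w u.

Lemma push_reduced x w : reduced w -> reduced (push x w).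
Proof.
case: w => [//|y w] /= rw.
by case: eqVneq => [_|xy] /=; [exact: path_sorted rw | rewrite xy].
Qed.

Lemma pushK x w : reduced w -> push x (push x w) = w.
Proof.
case: w => [|y w] /= rw; first by rewrite eqxx.
case: eqVneq => [->|_] /=; last by rewrite eqxx.
by case: w rw => [//|z w] /= /andP[/negPf ->].
Qed.

Lemma mulw_reduced u w : reduced w -> reduced (mulw u w).
Proof. by move=> rw; elim: u => //= x u; exact: push_reduced. Qed.

(** When [push] cancels the first letter of [u], the same letter is pushed twice on the right, and
    [pushK] undoes it. Associativity rests on this. *)
Lemma mulw_push x u w : reduced u -> reduced w ->
  mulw (push x u) w = push x (mulw u w).
Proof.
case: u => [//|y u] /= ru rw; case: eqVneq => [->|_] //=.
by rewrite pushK// mulw_reduced.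
Qed.

Lemma mulwA u v w : reduced v -> reduced w ->
  mulw u (mulw v w) = mulw (mulw u v) w.
Proof.
move=> rv rw; elim: u => //= x u ->.
by rewrite mulw_push// mulw_reduced.
Qed.

Lemma mulw1 u : reduced u -> mulw u [::] = u.
Proof.
elim: u => //= x u IH xu; rewrite IH; last exact: path_sorted xu.
by case: u xu {IH} => //= y u /andP[/negPf ->].
Qed.

Lemma mulVw u : mulw (rev u) u = [::].
Proof. by elim: u => //= x u IH; rewrite rev_cons /mulw foldr_rcons /= eqxx. Qed.

Lemma rev_reduced u : reduced u -> reduced (rev u).
Proof. by rewrite /reduced rev_sorted; under eq_sorted do rewrite eq_sym. Qed.

Lemma suffix_consE s x w : suffix s (x :: w) = (s == x :: w) || suffix s w.
Proof.
apply/idP/orP => [/suffixP[[|y t] /= e]|[/eqP ->|sw]].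
- by left; rewrite e.
- by right; case: e => _ ->; exact: suffix_suffix.
- exact: suffix_refl.
- exact: suffix_trans sw (suffix_cons _ _).
Qed.

End Words.

(* The free product of copies of [Z/2] indexed by [I]. *)
Record rword (I : finType) := RWord { word :> seq I; _ : reduced word }.

HB.instance Definition _ (I : finType) := [isSub for @word I].
HB.instance Definition _ (I : finType) := [Countable of rword I by <:].

Section Group.
Variable I : finType.
Implicit Types u v w : rword I.

Lemma word_reduced w : reduced w. Proof. exact: valP. Qed.

Definition rone : rword I := @RWord I [::] isT.
Definition rmul u w : rword I := RWord (mulw_reduced u (word_reduced w)).
Definition rinv w : rword I := RWord (rev_reduced (word_reduced w)).

Lemma rmulA : associative rmul.
Proof. by move=> u v w; apply/val_inj/mulwA; exact: word_reduced. Qed.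

Lemma rmul1 : left_id rone rmul.
Proof. by move=> w; exact: val_inj. Qed.

Lemma rmulr1 : right_id rone rmul.
Proof. by move=> w; apply/val_inj/mulw1/word_reduced. Qed.

Lemma rmulV : left_inverse rone rinv rmul.
Proof. by move=> w; apply/val_inj/mulVw. Qed.

Lemma rmulrV : right_inverse rone rinv rmul.
Proof. by move=> w; apply/val_inj; rewrite /= -{1}[val w]revK mulVw. Qed.

HB.instance Definition _ :=
  isGroup.Build (rword I) rmulA rmul1 rmulr1 rmulV rmulrV.

End Group.

Local Open Scope group_scope.

(** * Generators and non-amenability *)

Section Generators.
Variable I : finType.
Implicit Types (x y : I) (g h : rword I) (w : seq I).

Definition gen x : rword I := @RWord I [:: x] isT.

Definition eval w : rword I := foldr (fun x g => gen x * g) 1 w.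

Lemma word_gen x g : word (gen x * g) = push x g.
Proof. by []. Qed.

Lemma eval_word g : eval g = g.
Proof.
apply: val_inj; case: g => w /= rw; rewrite -[RHS]mulw1//.
by elim: w {rw} => //= x w ->.
Qed.

Lemma genK x : gen x * gen x = 1.
Proof. by apply: val_inj; rewrite /= eqxx. Qed.

Lemma mul_genK x g : gen x * (gen x * g) = g.
Proof. by rewrite mulgA genK mul1g. Qed.

Lemma genV x : (gen x)^-1 = gen x.
Proof. by apply: (mulgI (gen x)); rewrite genK mulgV. Qed.

Lemma rword_gen_ind (P : rword I -> Prop) :
  P 1 -> (forall x g, P g -> P (gen x * g)) -> forall g, P g.
Proof.
move=> P1 Pg g; rewrite -(eval_word g).
by elim: (word g) => //= x w; exact: Pg.
Qed.

Lemma gen_generates : generates [set gen x | x in [set: I]].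
Proof.
apply/seteqP; split=> // g _ H [[H1 HM _] sH].
by elim/rword_gen_ind: g => // x g; apply: HM; apply: sH; exists x.
Qed.

(* Left multiplication by [gen x] swaps the words that start with [x] and
   those that do not, so each class of first letters has measure 1/2. *)
Lemma rword_not_amenable (R : realType) : (2 < #|I|)%N -> ~ amenable R (rword I).
Proof.
move=> I3 [mu [mu0 muT muU muL]].
pose A x : set (rword I) := [set g | ohead (word g) = Some x].
have A2 x : (2 * mu (A x) = 1)%R.
  have -> : (2 * mu (A x) = mu (A x) + mu (lcoset (gen x) (A x)))%R.
    by rewrite muL; lra.
  rewrite -muU -?muT; last first.
    rewrite -subset0 => _ [] /[swap] -[g gA <-]; rewrite /A/= in gA *.
    have := word_reduced g; case: (word g) gA => //= y w [->].
    by rewrite eqxx; case: w => //= z w /andP[/eqP xz _] [] /esym.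
  congr mu; apply/seteqP; split=> // g _.
  have [gA|gA] := pselect (A x g); [by left|right].
  exists (gen x * g); last exact: mul_genK.
  rewrite /A/= in gA *; case: (word g) gA => //= y w.
  by case: eqVneq => [->|].
have disj x y : x != y -> A x `&` A y = set0.
  move=> /eqP xy; rewrite -subset0 => g [].
  by rewrite /A/= => -> [].
have mono B C : B `<=` C -> (mu B <= mu C)%R.
  move=> BC; rewrite -(setDUK BC) muU ?lerDl ?mu0//.
  by rewrite setDE setIC -setIA setICl setI0.
have [a [b [c [ab ac bc]]]] : exists a b c : I, [/\ a != b, a != c & b != c].
  have := enum_uniq I; move: I3; rewrite cardT.
  case: (enum I) => [//|a [//|b [//|c s]]] _ /=.
  rewrite !inE !negb_or => /and4P[/and3P[ab ac _] /andP[bc _] _ _].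
  by exists a, b, c.
(* Three disjoint classes of measure 1/2 exceed the total mass 1. *)
have := mono _ _ (@subsetT _ (A a `|` A b `|` A c)).
rewrite muT !muU ?disj// ?setIUl ?disj// ?setU0//.
by move: (A2 a) (A2 b) (A2 c); lra.
Qed.

End Generators.

(** * The action on a finite set of words and its stabilisers *)

Section Folding.
Variable I : finType.
Implicit Types (x y : I) (g h u v : rword I) (w : seq I) (T : seq (rword I)).

Definition fold_step T x u := if gen x * u \in T then gen x * u else u.

Definition foldw T w := foldr (fold_step T) 1 w.

Definition folding T g := foldw T (word g).

Definition stab T : set (rword I) := [set g | folding T g = 1].

Lemma fold_stepK T x u : u \in T -> fold_step T x (fold_step T x u) = u.
Proof.
move=> uT; rewrite /fold_step.
by case E: (_ * u \in T); rewrite ?mul_genK ?uT ?E.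
Qed.

Section Action.
Variable T : seq (rword I).
Hypothesis T1 : 1 \in T.

Lemma foldw_in w : foldw T w \in T.
Proof. by elim: w => //= x w IH; rewrite /fold_step; case: ifP. Qed.

(** A cancellation in [gen x * g] is harmless because [fold_step T x] is an involution on [T]; hence
    the steps define an action of the group. *)
Lemma folding_gen x g : folding T (gen x * g) = fold_step T x (folding T g).
Proof.
rewrite /folding word_gen; case: (word g) => //= y w.
by case: eqVneq => [->|//]; rewrite fold_stepK// foldw_in.
Qed.

Lemma folding_mul g h h' :
  folding T h = folding T h' -> folding T (g * h) = folding T (g * h').
Proof.
move=> hh'; elim/rword_gen_ind: g => [|x g]; first by rewrite !mul1g.
by rewrite -!mulgA !folding_gen => ->.
Qed.

(** Orbit-stabiliser: a coset is determined by the point of [T] to which it moves 1. *)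
Lemma lcoset_stab g :
  lcoset g (stab T) = [set h | folding T h = folding T g].
Proof.
apply/seteqP; split=> [_ [h hT <-]|h hg] /=.
  by rewrite (@folding_mul g h 1) ?mulg1.
exists (g^-1 * h); last by rewrite mulVKg.
by rewrite /stab/= (folding_mul _ hg) mulVg.
Qed.

Lemma stab_subgroup : is_subgroup (stab T).
Proof.
split=> [//|g h gT hT|g gT]; rewrite /stab/=.
  by rewrite (@folding_mul g h 1) ?mulg1.
by rewrite -[g^-1]mulg1 (@folding_mul _ 1 g) ?mulVg.
Qed.

Lemma stab_finite_index : finite_index (stab T).
Proof.
apply: (@sub_finite_set _ _
  ((fun t => [set h | folding T h = t]) @` [set` T])); last first.
  exact/finite_image/finite_seq.
move=> _ [g _ <-]; exists (folding T g); first exact: foldw_in.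
by rewrite lcoset_stab.
Qed.

End Action.

Lemma foldw_eval T w :
  (forall s, suffix s w -> eval s \in T) -> foldw T w = eval w.
Proof.
elim: w => //= x w IH sT; rewrite IH => [|s sw].
  by rewrite /fold_step (sT (x :: w) (suffix_refl _)).
by apply: sT; rewrite suffix_consE sw orbT.
Qed.

(** Connectedness of [T] in the Cayley tree, phrased as induction along the edges inside [T]. *)
Definition connected T := forall Q : rword I -> Prop,
  (forall u x, u \in T -> gen x * u \in T -> Q u -> Q (gen x * u)) ->
  forall t t', t \in T -> t' \in T -> Q t -> Q t'.

(** Right multiplication by this involution is the automorphism of the Cayley tree that flips the
    edge from [v] to [gen x * v]. *)
Definition reflection x v := v^-1 * (gen x * v).

Definition double T x v := T ++ [seq t * reflection x v | t <- T].

(** * Opening one loop by doubling *)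

Section Double.
Variables (T : seq (rword I)) (x : I) (v : rword I).
Hypotheses (T1 : 1 \in T) (Tconn : connected T) (vT : v \in T).
Hypotheses (xvT : gen x * v \notin T) (xv : word (gen x * v) = x :: v).

Let r := reflection x v.
Let T' := double T x v.

Let rK u : u * r * r = u.
Proof.
by rewrite -mulgA /r /reflection -!mulgA mulVKg mul_genK mulVg mulg1.
Qed.

Let vr : v * r = gen x * v. Proof. by rewrite mulVKg. Qed.

Lemma mem_double u : (u \in T') = (u \in T) || (u * r \in T).
Proof.
rewrite mem_cat; congr orb; apply/mapP/idP => [[t tT ->]|urT].
  by rewrite rK.
by exists (u * r); rewrite ?rK.
Qed.

(* The half-tree behind the edge from [v] to [gen x * v]. *)
Let D u := suffix (word (gen x * v)) (word u).

(** Prepending or cancelling one letter can create the suffix [x :: v] only by completing it. *)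
Let cross y u : D (gen y * u) -> ~~ D u -> u = v /\ y = x.
Proof.
rewrite /D xv word_gen => Dyu Du.
suff: x :: v = y :: u by case=> -> /val_inj ->.
case: (word u) Dyu Du => [|z w] /=; last case: eqVneq => [->|_].
- by rewrite suffix_consE suffixs0 /= orbF => /eqP.
- by move=> sw; rewrite suffix_consE sw orbT.
- by rewrite suffix_consE => /orP[/eqP//|->].
Qed.

(** A path in [T] from [v] into [D] would have to use the edge to [gen x * v], which is not in [T].
    With [Dr] this makes [T] and its reflected copy disjoint. *)
Let notD t : t \in T -> ~~ D t.
Proof.
move=> tT; apply: (@Tconn (fun u => ~~ D u) _ v t vT tT) => [u y uT yuT Du|].
  apply/negP => /cross /(_ Du)[uv yx]; move: xvT.
  by rewrite -uv -yx yuT.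
by apply/negP => /size_suffix; rewrite xv ltnn.
Qed.

Let Dr t : t \in T -> D (t * r).
Proof.
move=> tT; apply: (@Tconn (fun u => D (u * r)) _ v t vT tT) => [u y uT yuT Dur|].
  apply: contraT; rewrite -mulgA => Dyur.
  have [//|yurv yx] := @cross y (gen y * (u * r)) _ Dyur.
    by rewrite mul_genK.
  have uv : u = v.
    by rewrite -(rK u) -(mul_genK y (u * r)) yurv yx -vr rK.
  by move: xvT; rewrite -uv -yx yuT.
by rewrite vr /D suffix_refl.
Qed.

Lemma double_connected : connected T'.
Proof.
move=> Q QT' t t'; have TT' u : u \in T -> u \in T'.
  by rewrite mem_double => ->.
have TT'r u : u \in T -> u * r \in T' by rewrite mem_double rK orbC => ->.
have QT := Tconn (Q := Q) (fun u y uT yuT => QT' u y (TT' _ uT) (TT' _ yuT)).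
have QTr := Tconn (Q := fun u => Q (u * r)).
have {}QTr u u' : u \in T -> u' \in T -> Q (u * r) -> Q (u' * r).
  apply: QTr => {}u y uT yuT; rewrite -mulgA; apply: QT'.
    exact: TT'r.
  by rewrite mulgA; exact: TT'r.
have Qvr : Q v -> Q (v * r).
  by rewrite vr; apply: QT'; [exact: TT' | rewrite -vr; exact: TT'r].
have Qrv : Q (v * r) -> Q v.
  rewrite -{2}(mul_genK x v) vr; apply: QT'.
    by rewrite -vr; exact: TT'r.
  by rewrite mul_genK; exact: TT'.
rewrite !mem_double => /orP tT /orP t'T Qt.
have Qv : Q v.
  case: tT => tT; first exact: QT tT vT Qt.
  by apply/Qrv/(QTr _ _ tT vT); rewrite rK.
case: t'T => t'T; first exact: QT vT t'T Qv.
by rewrite -(rK t'); apply: QTr vT t'T (Qvr Qv).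
Qed.

(** The two walks move in parallel up to [r], except at the joining edge: there the walk in [T']
    changes halves while the walk in [T] stays at [v]. *)
Lemma foldw_double w :
  foldw T' w = foldw T w \/ foldw T' w = foldw T w * r.
Proof.
elim: w => /= [|y w IH]; first by left.
have := foldw_in T1 w; case: IH => ->; move: (foldw T w) => u uT.
  rewrite /fold_step mem_double; case yuT: (gen y * u \in T) => /=; first by left.
  case: ifP => yurT; [right|by left].
  have [|-> ->] := @cross y u _ (notD uT); last by rewrite vr.
  by rewrite -(rK (gen y * u)) Dr.
have yurr : gen y * (u * r) * r = gen y * u by rewrite (mulgA (gen y)) rK.
rewrite /fold_step mem_double yurr orbC.
case yuT: (gen y * u \in T) => /=; first by right; rewrite mulgA.
case: ifP => yurT; [left|by right].
have [||yurv yx] := @cross y (gen y * (u * r)) _ _.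
- by rewrite mul_genK Dr.
- exact: notD.
- rewrite yurv.
  by rewrite -(rK u) -(mul_genK y (u * r)) yurv yx -vr rK.
Qed.

Lemma stab_double : stab T' `<=` stab T.
Proof.
move=> g; rewrite /stab /folding/= => gT'.
(* Otherwise the walk in [T] would end at [r], the image of 1 in the other half. *)
have := foldw_double (word g); rewrite gT' => -[//|rT].
by have := notD (foldw_in T1 (word g)); rewrite -(rK (foldw T _)) -rT Dr.
Qed.

End Double.

(** * Exhausting the group by finite trees *)

Fixpoint grow T w :=
  if w is x :: w' then
    let T1 := grow T w' in
    if gen x * eval w' \in T1 then T1 else double T1 x (eval w')
  else T.

(** Suffixes are adjoined shortest first, so each loop is opened at a point already present. *)
Lemma grow_spec T w : 1 \in T -> connected T -> reduced w ->
  [/\ {subset T <= grow T w}, connected (grow T w),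
      stab (grow T w) `<=` stab T
    & forall s, suffix s w -> eval s \in grow T w].
Proof.
move=> T1 Tc; elim: w => [|x w IH] rw /=.
  by split=> // s; rewrite suffixs0 => /eqP ->.
have [sub Gc Gs Ge] := IH (path_sorted rw).
case: ifPn => xw.
  split=> // s; rewrite suffix_consE => /orP[/eqP ->//|]; exact: Ge.
have wG := Ge w (suffix_refl w).
have subD : {subset grow T w <= double (grow T w) x (eval w)}.
  by move=> t tG; rewrite mem_cat tG.
have ew (u : seq I) : reduced u -> word (eval u) = u.
  by move=> ru; rewrite (eval_word (RWord ru)).
have wE : word (gen x * eval w) = x :: eval w.
  by rewrite [LHS](ew (x :: w) rw) (ew w (path_sorted rw)).
split.
- by move=> t /sub /subD.
- exact: double_connected.
- apply: subset_trans Gs; apply: stab_double => //; exact: sub.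
- move=> s; rewrite suffix_consE => /orP[/eqP ->|sw]; last exact/subD/Ge.
  rewrite /= mem_cat; apply/orP; right; apply/mapP.
  by exists (eval w); rewrite ?mulVKg.
Qed.

Fixpoint tree n : seq (rword I) :=
  if n is m.+1 then
    if unpickle m is Some g then grow (tree m) (word g) else tree m
  else [:: 1].

Lemma tree_spec n : 1 \in tree n /\ connected (tree n).
Proof.
elim: n => [|n [T1 Tc]] /=.
  by split=> [|Q _ t t']; rewrite !inE // => /eqP -> /eqP ->.
case: unpickle => // g.
by have [sub Gc _ _] := grow_spec T1 Tc (word_reduced g); split=> //; exact: sub.
Qed.

Lemma tree1 n : 1 \in tree n. Proof. by have [] := tree_spec n. Qed.

Lemma stab_tree_subset n : stab (tree n.+1) `<=` stab (tree n).
Proof.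
have [T1 Tc] := tree_spec n; rewrite /=; case: unpickle => // g.
by have [] := grow_spec T1 Tc (word_reduced g).
Qed.

Lemma bigcap_stab_tree : \bigcap_n stab (tree n) = [set 1].
Proof.
apply/seteqP; split=> [g gH|_ -> n _]; last by [].
have [T1 Tc] := tree_spec (pickle g).
(* Stage [(pickle g).+1] is the one that adjoins [g]; there the walk along [g] is never blocked and
   ends at [g], so stabilising 1 forces [g] to be 1. *)
have := gH (pickle g).+1 Logic.I; rewrite /stab /folding/= pickleK => <-.
have [_ _ _ ge] := grow_spec T1 Tc (word_reduced g).
by rewrite foldw_eval ?eval_word.
Qed.

End Folding.

(** * Weighted hyperfiniteness of forests *)

Section Forest.
Variables (R : realType) (I : finType).

(** A vertex is a tree index with the path to the root; the empty word is the root, and the head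
    letter leads to the parent. *)
Definition parent_edge (p q : nat * seq I) :=
  p.1 = q.1 /\ exists x, q.2 = x :: p.2.

(* The depth classes modulo [k] partition the total weight, so one of them
   carries at most [1/k] of it.  Removing it leaves components on which the
   nearest ancestor of the removed depth is constant, and a vertex is
   determined by that ancestor and a word of length at most [k]. *)
Lemma forest_weighted_hyperfinite (C : fgraph -> Prop) :
  (forall F, C F -> exists phi : F -> nat * seq I, injective phi /\
     forall x y : F, fadj x y ->
       parent_edge (phi x) (phi y) \/ parent_edge (phi y) (phi x)) ->
  weighted_hyperfinite R C.
Proof.
move=> Cforest eps eps0.
pose k := (Num.bound eps^-1).+1.
have keps : (1 <= eps * k%:R)%R.
  rewrite mulrC -ler_pdivrMr// div1r; apply: ltW.
  apply: lt_le_trans (archi_boundP _) _; first by rewrite invr_ge0 ltW.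
  by rewrite ler_nat leqnSn.
exists #|{bseq k of I}|; split.
  by apply/card_gt0P; exists [bseq].
move=> F /Cforest[phi [phi_inj phi_adj]] w w0.
(* This is the depth minus [j] modulo [k], written with [k - j] to avoid truncation. At depths below
   [j] it exceeds the depth, so the later [drop] yields the empty word. *)
pose m (j : 'I_k) (x : F) := ((size (phi x).2 + (k - j)) %% k)%N.
have ltm j x : (m j x < k)%N by rewrite ltn_mod.
pose Y j := [set x | m j x == 0%N]%SET.
have [j Yj] : exists j, (k%:R * \sum_(y in Y j) w y <= \sum_x w x)%R.
  apply: contrapT => /forallNP Ylt.
  have : (\sum_(j < k) \sum_x w x <
          \sum_(j < k) k%:R * \sum_(y in Y j) w y)%R.
    apply: ltr_sum => [|j _].
      by apply/hasP; exists ord0 => //; exact: mem_index_enum.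
    by rewrite ltNge; apply/negP/Ylt.
  rewrite -mulr_sumr sumr_const card_ord -[ltLHS]mulr_natl.
  rewrite (exchange_big_dep xpredT)//= ltr_pM2l ?ltr0n//.
  apply/negP; rewrite -leNgt; apply: ler_sum => x _.
  pose j0 : 'I_k := Ordinal (ltn_pmod (size (phi x).2) (ltn0Sn _ : 0 < k)%N).
  rewrite (big_pred1 j0)// => j; rewrite inE /m -[LHS]/(_ == 0 %% k)%N.
  rewrite -(eqn_modDr j) -addnA subnK ?(ltnW (ltn_ord j))// add0n modnDr.
  by rewrite (modn_small (ltn_ord j)) eq_sym.
exists (Y j); split.
  rewrite -(ler_pM2l (ltr0Sn R (Num.bound eps^-1))) -/k.
  apply: le_trans Yj _; rewrite mulrA (mulrC _ eps) ler_peMl//.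
  exact: sumr_ge0.
move=> x xY.
pose anc (y : F) := ((phi y).1, drop (m j y) (phi y).2).
(* As the child [z] is not removed, its residue does not wrap to 0, and [drop] absorbs the extra
   letter. *)
have anc_edge y z : z \notin Y j -> parent_edge (phi y) (phi z) ->
    anc y = anc z.
  rewrite inE /anc => zY [-> [a pz]].
  have mz : m j z = (m j y).+1.
    move: zY; rewrite /m pz /= addSn -addn1 -modnDml addn1 -/(m j y).
    have := ltm j y; rewrite leq_eqVlt => /orP[/eqP ->|lt _].
      by rewrite modnn.
    by rewrite modn_small.
  by rewrite mz pz.
have anc_conn y : connect (delete_vertices (Y j)) x y -> anc y = anc x.
  case/connectP => p; elim: p x {xY} => [|z p IH] x /=; first by move=> _ ->.
  case/andP => /and3P[xY zY /phi_adj xz] /IH{}IH /IH ->.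
  by case: xz => /anc_edge ->.
pose code y : {bseq k of I} := insub_bseq k (take (m j y) (phi y).2).
have codeE y : val (code y) = take (m j y) (phi y).2.
  by apply: insubdK; rewrite -topredE /= size_take_min geq_min ltnW.
rewrite -(card_in_imset (f := code)); first exact: max_card.
move=> y z; rewrite !inE => /anc_conn yx /anc_conn zx /(congr1 val).
rewrite !codeE => tyz; apply: phi_inj.
have : anc y = anc z by rewrite yx zx.
rewrite /anc => -[e1 e2]; rewrite [LHS]surjective_pairing.
rewrite -(cat_take_drop (m j y) (phi y).2) tyz e1 e2 cat_take_drop.
by rewrite -surjective_pairing.
Qed.

Lemma forest_bounded_degree (S : graph) (phi : S -> nat * seq I) :
  injective phi ->
  (forall x y : S, adj x y ->
     parent_edge (phi x) (phi y) \/ parent_edge (phi y) (phi x)) ->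
  bounded_degree S.
Proof.
move=> phi_inj phi_adj; exists #|I|.+1 => x.
(* Index 0 gives the parent, the others the children; at the root [behead] returns the root itself,
   harmless for an upper bound. *)
pose nb i :=
  if i is i'.+1 then
    ((phi x).1, oapp (fun a => a :: (phi x).2) [::] (onth (enum I) i'))
  else ((phi x).1, behead (phi x).2).
have sub : phi @` [set y | adj x y] `<=` nb @` `I_#|I|.+1.
  move=> _ [y /phi_adj + <-] => -[[e [a pa]]|[e [a pa]]].
    exists (index a (enum I)).+1.
      by rewrite /= ltnS cardE index_mem mem_enum.
    rewrite /= onthE (nth_map a) ?index_mem ?mem_enum//.
    rewrite nth_index ?mem_enum//= e -pa.
    by rewrite -surjective_pairing.
  by exists 0%N => //=; rewrite pa /= -e -surjective_pairing.
rewrite -(card_le_eql (inj_card_eq (in2W phi_inj))).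
exact: card_le_trans (subset_card_le sub) (card_image_le nb _).
Qed.

Lemma forest_propertyA (S : graph) (phi : S -> nat * seq I) :
  injective phi ->
  (forall x y : S, adj x y ->
     parent_edge (phi x) (phi y) \/ parent_edge (phi y) (phi x)) ->
  propertyA R S.
Proof.
move=> phi_inj phi_adj; split; first exact: forest_bounded_degree phi_adj.
apply: forest_weighted_hyperfinite => F [f [f_inj f_adj]].
exists (phi \o f); split; first exact: inj_comp.
by move=> x y /f_adj /phi_adj.
Qed.

End Forest.

(** * The Schreier graphs form a forest *)

Section TreeSchreier.
Variable I : finType.
Let Sigma : set (rword I) := [set gen x | x in [set: I]].
Let Gs n := schreier_graph (stab (tree I n)) Sigma.

Let rep n (A : Gs n) : rword I := s2val (cid2 (svalP A)).

Let repK n (A : Gs n) : lcoset (rep A) (stab (tree I n)) = sval A.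
Proof. exact: s2valP' (cid2 (svalP A)). Qed.

Let sval_inj n (A B : Gs n) : sval A = sval B -> A = B.
Proof.
by move=> AB; apply: eq_sig_hprop AB => ? ? ?; exact: Prop_irrelevance.
Qed.

Let phi (A : disjoint_union Gs) : nat * seq I :=
  (projT1 A, word (folding (tree I (projT1 A)) (rep (projT2 A)))).

(** By [lcoset_stab] the choice of representative in [phi] does not matter. *)
Let phiE n (A : Gs n) g : sval A = lcoset g (stab (tree I n)) ->
  phi (existT _ n A) = (n, word (folding (tree I n) g)).
Proof.
move=> Ag; congr (_, word _) => /=.
have := repK A; rewrite Ag !lcoset_stab ?tree1// => /seteqP[+ _].
by apply.
Qed.

Lemma schreier_tree_propertyA (R : realType) : seq_propertyA R Gs.
Proof.
apply: (@forest_propertyA R I _ phi) => [[n A] [n' B]|A B].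
  rewrite -[phi (existT _ n A)]/(n, _) -[phi (existT _ n' B)]/(n', _).
  case=> nn'; subst n' => /val_inj AB; congr existT.
  apply: sval_inj; rewrite /= -!repK !lcoset_stab ?tree1//.
  by rewrite AB.
case=> n {}A {}B [AB st].
wlog : A B AB st / schreier_step Sigma A B.
  move=> W; case: (st) => sAB; first exact: W.
  by apply/or_comm/(W _ _ (nesym AB) _ sAB); left.
case=> g [_ [[x _ <-] Ag Bg]]; rewrite (phiE Ag) (phiE Bg) folding_gen ?tree1//.
(* Distinct cosets exclude a blocked step, so the edge is a genuine multiplication by [gen x]: it
   adds a letter or cancels one. *)
have : folding (tree I n) (gen x * g) <> folding (tree I n) g.
  move=> e; apply: AB; apply: sval_inj.
  by rewrite Ag Bg !lcoset_stab ?tree1// e.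
rewrite folding_gen ?tree1// /fold_step; case: ifP => // _ _.
rewrite /parent_edge word_gen /=.
case: (word _) => [|y w] /=; first by left; split=> //; exists x.
case: eqVneq => _; last by left; split=> //; exists x.
by right; split=> //; exists y.
Qed.

End TreeSchreier.

Theorem proposition1p1 (R : realType) :
  exists (Gamma : groupType) (Sigma : set Gamma) (H : nat -> set Gamma),
    ~ amenable R Gamma /\
    [/\ finite_set Sigma, symmetric_set Sigma & generates Sigma] /\
    (forall i, is_subgroup (H i) /\ finite_index (H i)) /\
    (forall i, H i.+1 `<=` H i) /\
    \bigcap_i H i = [set 1%g] /\
    seq_propertyA R (fun i => schreier_graph (H i) Sigma).
Proof.
(* Three letters, since with two the group is infinite dihedral and amenable. *)
exists (rword 'I_3), [set gen x | x in [set: 'I_3]], (fun n => stab (tree _ n)).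
split; first by apply: rword_not_amenable; rewrite card_ord.
split; first split.
- exact/finite_image/finite_finset.
- by move=> _ [x _ <-]; rewrite genV; exists x.
- exact: gen_generates.
split.
  by move=> n; split; [apply: stab_subgroup | apply: stab_finite_index];
    exact: tree1.
split; first exact: stab_tree_subset.
by split; [exact: bigcap_stab_tree | exact: schreier_tree_propertyA].
Qed.
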